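(* Let $b\ge 2$, $s\ge 2$, $d\ge 1$, $t\ge 0$ and $m$ be integers with $0\le t\le m$ and $m\ge 9(d+t)(s-1)^2$. Let $E_m=\{[y]_m : y\in[0,1)\}$, and let $(\mathbf{x}_n)_{0\le n<b^m}$ be a $d$-admissible $(t,m,s)$-net in base $b$. Then $$\max_{\mathbf{w}\in E_m^s} b^m D^*\big((\mathbf{x}_n\oplus\mathbf{w})_{0\le n<b^m}\big)\ \ge\ b^{-d}K_{d,t,s}^{-s+1}m^{s-1},\qquad\text{where } K_{d,t,s}=4(d+t)(s-1)^2 .$$
   Context: Fix an integer base $b\ge 2$ and let $Z_b=\{0,\dots,b-1\}$. Each $x\in[0,1)$ is identified with its $b$-adic digit sequence $x=\sum_{j\ge1}x_jb^{-j}$, $x_j\in Z_b$, chosen not to end in infinitely many digits $b-1$. Truncation: $[x]_m=\sum_{j=1}^m x_jb^{-j}$; thus $E_m=\{ab^{-m}:0\le a<b^m\}$. Digital shift: for $x,\gamma\in[0,1)$ with digits $x_j,\gamma_j$, $x\oplus\gamma=\sum_{j\ge1}v_jb^{-j}$ with $v_j\in Z_b$, $v_j\equiv x_j+\gamma_j \pmod b$; similarly $x\ominus\gamma$ uses $v_j\equiv x_j-\gamma_j\pmod b$. For points of $[0,1)^s$, truncation, $\oplus$ and $\ominus$ act coordinatewise. Valuation: if $v=\sum_j v_jb^{-j}$ has $v_1=\dots=v_k=0$, $v_{k+1}\neq0$, then $\|v\|_b=b^{-k-1}$; $\|v\|_b=0$ if all digits vanish; for $\mathbf{v}\in[0,1)^s$,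 $\|\mathbf{v}\|_b=\prod_{i=1}^s\|v^{(i)}\|_b$. Discrepancy: for points $(\mathbf{y}_n)_{0\le n<N}$ in $[0,1)^s$ and $\boldsymbol\gamma\in(0,1]^s$, let $J_{\boldsymbol\gamma}=\prod_{i=1}^s[0,\gamma_i)$, $\Delta((\mathbf{y}_n)_{0\le n<N},J_{\boldsymbol\gamma})=\#\{0\le n<N:\mathbf{y}_n\in J_{\boldsymbol\gamma}\}-N\gamma_1\cdots\gamma_s$, and $D^*((\mathbf{y}_n)_{0\le n<N})=\sup_{\boldsymbol\gamma\in(0,1]^s}|\Delta((\mathbf{y}_n)_{0\le n<N},J_{\boldsymbol\gamma})|/N$. Nets: for integers $0\le u\le m$ and $\mathbf{e}=(e_1,\dots,e_s)\in\mathbb{N}^s$, a $(u,m,\mathbf{e},s)$-net in base $b$ is a point set of $b^m$ points in $[0,1)^s$ such that every box $J=\prod_{i=1}^s[a_ib^{-d_i},(a_i+1)b^{-d_i})$ with integers $d_i\ge0$, $0\le a_i<b^{d_i}$, $e_i\mid d_i$ and volume $\mathrm{Vol}(J)\ge b^{u-m}$ contains exactly $b^m\mathrm{Vol}(J)$ of the points. A $(t,m,s)$-net is a $(t,m,(1,\dots,1),s)$-net. A point set $(\mathbf{x}_n)_{0\le n<b^m}$ in $[0,1)^s$ is $d$-admissible in base $b$ if $\min_{0\le k<n<b^m}\|\mathbf{x}_n\ominus\mathbf{x}_k\|_b>b^{-m-d}$. *)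

(* Defs.v *)
From HB Require Import structures.
From mathcomp Require Import all_boot all_order all_algebra.
From mathcomp Require Import all_classical all_reals all_analysis.

Set Implicit Arguments.
Unset Strict Implicit.
Unset Printing Implicit Defensive.

Import Order.TTheory GRing.Theory Num.Theory numFieldNormedType.Exports.

Local Open Scope classical_set_scope.
Local Open Scope ring_scope.

Section Digits.
Context {R : realType}.
Variable b : nat.

(* Indices start at 0: [digit x k] is the coefficient of [b ^- k.+1] in the
   b-adic expansion of [x] in [0, 1) that does not end in digits [b - 1]. *)
Definition digit (x : R) (k : nat) : nat :=
  (Num.truncn (x * b%:R ^+ k.+1) %% b)%N.

Definition of_digits (v : nat -> nat) : R :=
  limn (series (fun k => (v k)%:R * b%:R ^- k.+1 : R)).

Definition trunc (m : nat) (x : R) : R :=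
  \sum_(k < m) (digit x k)%:R * b%:R ^- k.+1.

Definition E_ (m : nat) : set R := [set trunc m y | y in `[0, 1[].

Definition add_digits (x y : R) (k : nat) : nat :=
  ((digit x k + digit y k) %% b)%N.

Definition sub_digits (x y : R) (k : nat) : nat :=
  ((digit x k + (b - digit y k)) %% b)%N.

Definition oplus {s : nat} (x w : 'rV[R]_s) : 'rV[R]_s :=
  \row_i of_digits (add_digits (x 0 i) (w 0 i)).

(* The valuation is read off a digit sequence, not off its sum: a digitwise
   difference may end in digits [b - 1], and need not be the canonical expansion
   of the real number it represents. *)
Definition valuation (v : nat -> nat) : R :=
  if pselect (exists k, v k != 0%N) is left ex
  then b%:R ^- (ex_minn ex).+1 else 0.

Definition ominus_valuation {s : nat} (x y : 'rV[R]_s) : R :=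
  \prod_(i < s) valuation (sub_digits (x 0 i) (y 0 i)).

End Digits.

Section Nets.
Context {R : realType} {s : nat}.

Definition in_box (lo hi x : 'rV[R]_s) : bool :=
  [forall i, lo 0 i <= x 0 i < hi 0 i].

Definition count_box (N : nat) (y : 'I_N -> 'rV[R]_s) (lo hi : 'rV[R]_s) : nat :=
  #|[pred n | in_box lo hi (y n)]|.

Definition vol (lo hi : 'rV[R]_s) : R := \prod_(i < s) (hi 0 i - lo 0 i).

Definition Delta (N : nat) (y : 'I_N -> 'rV[R]_s) (g : 'rV[R]_s) : R :=
  (count_box y 0 g)%:R - N%:R * \prod_(i < s) g 0 i.

Definition Dstar (N : nat) (y : 'I_N -> 'rV[R]_s) : R :=
  sup [set `|Delta y g| / N%:R | g in [set g : 'rV[R]_s | forall i, 0 < g 0 i <= 1]].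

Definition elem_lo (b : nat) (d a : 'I_s -> nat) : 'rV[R]_s :=
  \row_i ((a i)%:R * b%:R ^- d i).

Definition elem_hi (b : nat) (d a : 'I_s -> nat) : 'rV[R]_s :=
  \row_i ((a i).+1%:R * b%:R ^- d i).

(* [b ^- (m - u)] is b^(u-m), as [u <= m]. *)
Definition is_net_e (b u m : nat) (e : 'I_s -> nat)
    (x : 'I_(b ^ m) -> 'rV[R]_s) : Prop :=
  [/\ (u <= m)%N,
      forall i, (0 < e i)%N,
      forall n i, 0 <= x n 0 i < 1 &
      forall d a : 'I_s -> nat,
        (forall i, (a i < b ^ d i)%N) -> (forall i, (e i %| d i)%N) ->
        let lo := elem_lo b d a in let hi := elem_hi b d a in
        b%:R ^- (m - u) <= vol lo hi ->
        (count_box x lo hi)%:R = b%:R ^+ m * vol lo hi].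

Definition is_net (b t m : nat) (x : 'I_(b ^ m) -> 'rV[R]_s) : Prop :=
  is_net_e t (fun=> 1%N) x.

Definition admissible (b m d : nat) (x : 'I_(b ^ m) -> 'rV[R]_s) : Prop :=
  forall k n : 'I_(b ^ m), (k < n)%N ->
    b%:R ^- (m + d) < ominus_valuation b (x n) (x k).

End Nets.

Definition is_max {R : realType} (A : set R) (M : R) : Prop := A M /\ ubound A M.

Definition K_ (d t s : nat) : nat := (4 * (d + t) * (s - 1) ^ 2)%N.

(* Main.v *)
(* Let x_0 be the first point of the net, and let gamma have b-adic digits 0 and 1
   in its first m places; choose the shift w so that the first m digits of x_0 + w
   are those of gamma.  Cutting each [0, gamma_i) at the digits 1 of gamma_i splits
   J_gamma into elementary boxes, one for each choice of positions f_1, ..., f_s of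
   digits 1, with volume b^-(f_1 + ... + f_s).  If the sum of the f_i is at most
   m - t, the net property makes the box fair; if it is at least m + d, the box is
   empty, since a point in it would share with x_0 + w exactly the digits before
   f_1, ..., f_s, against admissibility.  The digits 1 are placed along arithmetic
   progressions of step d + t whose residues force the sum to be m + d modulo
   d + t, hence never strictly between m - t and m + d.  So no box has positive
   discrepancy, and each of those with sum exactly m + d contributes -b^-d; there
   are at least (m / K)^(s-1) of them, because the positions in all coordinates
   but one can be chosen freely in a range. *)
Require Import Defs.
From HB Require Import structures.
From mathcomp Require Import all_boot all_order all_algebra.
From mathcomp Require Import all_classical all_reals all_analysis.
From mathcomp Require Import zify ring.

Set Implicit Arguments.
Unset Strict Implicit.
Unset Printing Implicit Defensive.

Import Order.TTheory GRing.Theory Num.Theory numFieldNormedType.Exports.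

Local Open Scope classical_set_scope.
Local Open Scope ring_scope.

(** * Integers read off digit prefixes *)

Fixpoint numeral (b : nat) (v : nat -> nat) (n : nat) : nat :=
  if n is n'.+1 then (numeral b v n' * b + v n')%N else 0%N.

Section Numerals.
Variable b : nat.

Lemma eq_numeral (u v : nat -> nat) n :
  (forall k, (k < n)%N -> u k = v k) -> numeral b u n = numeral b v n.
Proof.
elim: n => //= n IHn uv; rewrite uv ?IHn // => k kn.
by apply: uv; apply: ltnW.
Qed.

Lemma numeral_inj (u v : nat -> nat) n :
  (forall k, (u k < b)%N) -> (forall k, (v k < b)%N) ->
  numeral b u n = numeral b v n -> forall k, (k < n)%N -> u k = v k.
Proof.
move=> ub vb; elim: n => //= n IHn uv k.
have b_gt0 : (0 < b)%N by apply: leq_trans (ub 0%N).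
have uvn : u n = v n.
  by have := congr1 (modn^~ b) uv; rewrite !modnMDl !modn_small.
rewrite ltnS leq_eqVlt => /predU1P[->//|]; apply: IHn.
by have := congr1 (divn^~ b) uv; rewrite !divnMDl // !divn_small // !addn0.
Qed.

Lemma numeral_bound (v : nat -> nat) n :
  (forall k, (v k < b)%N) -> (numeral b v n < b ^ n)%N.
Proof.
move=> vb; elim: n => [|n IHn]; first by rewrite expn0.
rewrite expnSr (@leq_trans ((numeral b v n).+1 * b)%N)  ?leq_mul2r ?IHn ?orbT //=.
by rewrite mulSn addnC ltn_add2r.
Qed.

Lemma numeral_div (v : nat -> nat) n k :
  (forall k, (v k < b)%N) -> (numeral b v (n + k) %/ b ^ k)%N = numeral b v n.
Proof.
move=> vb; have b_gt0 : (0 < b)%N by apply: leq_trans (vb 0%N).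
elim: k => [|k IHk]; first by rewrite addn0 expn0 divn1.
rewrite addnS expnS divnMA /=.
by rewrite divnMDl // (divn_small (vb _)) addn0.
Qed.

End Numerals.

(** * Base-[b] expansions of reals and elementary intervals *)

Section RealDigits.
Context {R : realType}.
Variable b : nat.
Hypothesis b_gt1 : (1 < b)%N.

Let b_gt0 : (0 < b)%N. Proof. exact: ltnW. Qed.
Let bX_gt0 n : 0 < b%:R ^+ n :> R. Proof. by rewrite exprn_gt0 ?ltr0n. Qed.
Let bX_ge0 n : 0 <= b%:R ^+ n :> R. Proof. exact/ltW. Qed.
Let bX_neq0 n : b%:R ^+ n != 0 :> R. Proof. exact: lt0r_neq0. Qed.

Lemma digit_lt (x : R) k : (digit b x k < b)%N.
Proof. by rewrite ltn_mod. Qed.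

Lemma truncn_mulX (z : R) k : 0 <= z ->
  (Num.truncn (z * b%:R ^+ k) %/ b ^ k)%N = Num.truncn z.
Proof.
move=> z_ge0; have zX_ge0 : 0 <= z * b%:R ^+ k by rewrite mulr_ge0 ?bX_ge0.
have bk_gt0 : (0 < b ^ k)%N by rewrite expn_gt0 b_gt0.
have /andP[lo hi] := truncn_itv zX_ge0.
apply/esym/eqP; rewrite truncn_eq //; apply/andP; split.
  rewrite -(ler_pM2r (bX_gt0 k)). apply: le_trans lo.
  by rewrite -natrX -natrM ler_nat leq_trunc_div.
rewrite -(ltr_pM2r (bX_gt0 k)); apply: lt_le_trans hi _.
by rewrite -natrX -natrM ler_nat ltn_ceil.
Qed.

Lemma truncn_numeral (x : R) n : 0 <= x < 1 ->
  Num.truncn (x * b%:R ^+ n) = numeral b (digit b x) n.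
Proof.
move=> /andP[x_ge0 x_lt1]; elim: n => [|n IHn] /=.
  by rewrite expr0 mulr1; apply/eqP; rewrite truncn_eq // x_ge0.
rewrite -IHn [LHS](divn_eq _ b) /digit.
have := @truncn_mulX (x * b%:R ^+ n) 1; rewrite expn1 => <-.
  by rewrite -mulrA -exprSr.
by rewrite mulr_ge0 ?bX_ge0.
Qed.

(** Elementary intervals are the fibres of the digit-prefix map. This turns box membership into a
    digit condition, the common language of the net property and admissibility. *)
Lemma elem_interval_numeral (x : R) a n : 0 <= x < 1 ->
  (a%:R * b%:R ^- n <= x < a.+1%:R * b%:R ^- n) = (numeral b (digit b x) n == a).
Proof.
move=> x01; rewrite -truncn_numeral // truncn_eq.
  by rewrite ler_pdivrMr ?ltr_pdivlMr.
by case/andP: x01 => x_ge0 _; rewrite mulr_ge0 ?bX_ge0.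
Qed.

Lemma sum_digits_numeral (v : nat -> nat) n :
  \sum_(k < n) (v k)%:R * b%:R ^- k.+1 = (numeral b v n)%:R * b%:R ^- n :> R.
Proof.
elim: n => [|n IHn]; first by rewrite big_ord0 mul0r.
rewrite big_ord_recr /= IHn natrD natrM exprS.
have b_neq0 : b%:R != 0 :> R by rewrite pnatr_eq0 -lt0n.
have bn_neq0 := bX_neq0 n.
by field; rewrite b_neq0 bn_neq0.
Qed.

Lemma digit_of_truncn (y : R) (v : nat -> nat) m :
  0 <= y -> (forall k, (v k < b)%N) ->
  Num.truncn (y * b%:R ^+ m) = numeral b v m ->
  forall k, (k < m)%N -> digit b y k = v k.
Proof.
move=> y_ge0 vb ym k km; rewrite /digit.
have yk_ge0 : 0 <= y * b%:R ^+ k.+1 by rewrite mulr_ge0 ?bX_ge0.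
rewrite -(truncn_mulX (m - k.+1) yk_ge0) -mulrA -exprD subnKC // ym.
by rewrite -{1}(subnKC km) numeral_div //= modnMDl modn_small.
Qed.

Lemma digit_finite_sum (v : nat -> nat) m (k : nat) : (forall k, (v k < b)%N) ->
  digit b (\sum_(j < m) (v j)%:R * b%:R ^- j.+1 : R) k =
  if (k < m)%N then v k else 0%N.
Proof.
move=> vb; rewrite sum_digits_numeral; set y := (X in digit b X).
have y_ge0 : 0 <= y by rewrite divr_ge0 ?ler0n ?bX_ge0.
case: ltnP => km.
  by apply: (digit_of_truncn _ vb _ km); rewrite // mulfVK // natrK.
(* For [k >= m] the scaled sum is an integer multiple of [b], so the digit is 0. *)
rewrite /digit /y -(subnKC (leqW km)) exprD mulrA mulfVK // subSn // exprS.
rewrite -natrX -!natrM natrK.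
by rewrite mulnCA modnMr.
Qed.

Lemma finite_sum_itv (v : nat -> nat) m : (forall k, (v k < b)%N) ->
  0 <= (\sum_(j < m) (v j)%:R * b%:R ^- j.+1 : R) < 1.
Proof.
move=> vb; rewrite sum_digits_numeral divr_ge0 ?ler0n ?bX_ge0 //=.
by rewrite ltr_pdivrMr // mul1r -natrX ltr_nat numeral_bound.
Qed.

Lemma E_finite_sum (v : nat -> nat) m : (forall k, (v k < b)%N) ->
  E_ b m (\sum_(j < m) (v j)%:R * b%:R ^- j.+1 : R).
Proof.
move=> vb; exists (\sum_(j < m) (v j)%:R * b%:R ^- j.+1).
  by rewrite /= in_itv /= finite_sum_itv.
by rewrite /trunc; apply: eq_bigr => k _; rewrite digit_finite_sum // ltn_ord.
Qed.

Lemma E_numeral m (w : R) : E_ b m w ->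
  exists2 a, (a < b ^ m)%N & w = a%:R * b%:R ^- m.
Proof.
case=> y _ <-; exists (numeral b (digit b y) m).
  by apply: numeral_bound => k; apply: digit_lt.
by rewrite /trunc sum_digits_numeral.
Qed.

Lemma digit_E m (w : R) k : E_ b m w -> (m <= k)%N -> digit b w k = 0%N.
Proof.
case=> y _ <- mk; rewrite /trunc digit_finite_sum; first by rewrite ltnNge mk.
exact: digit_lt.
Qed.

(** The [n]-th partial sum is the integer part of [x * b^n] divided by [b^n], hence lies between
    [x - b^-n] and [x]. *)
Lemma cvg_digit_series (x : R) : 0 <= x < 1 ->
  (series (fun k => (digit b x k)%:R * b%:R ^- k.+1 : R) @ \oo --> x)%classic.
Proof.
move=> x01; case/andP: (x01) => x_ge0 _.
have bV : `|b%:R^-1| < 1 :> R.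
  by rewrite ger0_norm ?invr_ge0 // invf_lt1 ?ltr0n // ltr1n.
have xlo : (x - (geometric 1 b%:R^-1 : R^nat) n @[n --> \oo] --> x)%classic.
  rewrite -[X in (_ --> X)%classic]subr0; apply: cvgB; first exact: cvg_cst.
  exact: cvg_geometric.
apply: squeeze_cvgr xlo (cvg_cst x); apply: nearW => n /=.
rewrite /series /= big_mkord sum_digits_numeral -truncn_numeral //.
rewrite mul1r exprVn lerBlDr.
have xn_ge0 : 0 <= x * b%:R ^+ n by rewrite mulr_ge0 ?bX_ge0.
rewrite ler_pdivrMr // truncn_le xn_ge0 andbT -{2}[b%:R ^- n]mul1r -mulrDl.
by rewrite ler_pdivlMr // natr1 ltW // truncnS_gt.
Qed.

(** * Digitwise addition of a point of [E_ b m] *)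

Section Shift.
Variables (m : nat) (x w : R).
Hypotheses (x01 : 0 <= x < 1) (wE : E_ b m w).

Let add_lt k : (add_digits b x w k < b)%N. Proof. by rewrite ltn_mod. Qed.

(* From [m] on, the digits of [x] are unchanged; in particular the digitwise sum
   is a canonical expansion. *)
Lemma of_digits_add :
  of_digits b (add_digits b x w) =
  x - trunc b m x + \sum_(k < m) (add_digits b x w k)%:R * b%:R ^- k.+1.
Proof.
apply: cvg_lim => //.
set c := _ - trunc b m x; set S := \sum_(k < m) _.
apply: cvg_trans
  (cvgD (cvgB (cvg_digit_series x01) (cvg_cst (trunc b m x))) (cvg_cst S)).
apply: near_eq_cvg; near=> n.
have mn : (m <= n)%N by near: n; exists m.
have -> : trunc b m x = series (fun k => (digit b x k)%:R * b%:R ^- k.+1) m.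
  by rewrite /series /= big_mkord.
have -> : S = series (fun k => (add_digits b x w k)%:R * b%:R ^- k.+1) m.
  by rewrite /series /= big_mkord.
rewrite /= !fctE /= /series /= !(big_cat_nat (leq0n m) mn) /=.
rewrite [X in X - _]addrC addrK addrC; congr (_ + _).
apply: eq_big_nat => k /andP[mk _].
by rewrite /add_digits (digit_E wE mk) addn0 modn_small ?digit_lt.
Unshelve. all: by end_near.
Qed.

(** After scaling by [b^m], the shift keeps the fractional part and replaces the integer part; the
    range and the first [m] digits of the shifted point follow. *)
Let scaled_shift :
  of_digits b (add_digits b x w) * b%:R ^+ m =
  (x * b%:R ^+ m - (Num.truncn (x * b%:R ^+ m))%:R) +
  (numeral b (add_digits b x w) m)%:R.
Proof.
rewrite of_digits_add /trunc !sum_digits_numeral -truncn_numeral //.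
by rewrite mulrDl mulrBl !mulfVK.
Qed.

Let frac_itv :
  0 <= x * b%:R ^+ m - (Num.truncn (x * b%:R ^+ m))%:R < 1.
Proof.
case/andP: x01 => x_ge0 _.
have xm_ge0 : 0 <= x * b%:R ^+ m by rewrite mulr_ge0 ?bX_ge0.
by rewrite subr_ge0 truncn_le xm_ge0 ltrBlDl natr1 truncnS_gt.
Qed.

Lemma of_digits_add_itv : 0 <= (of_digits b (add_digits b x w) : R) < 1.
Proof.
case/andP: frac_itv => f_ge0 f_lt1; apply/andP; split.
  by rewrite -(pmulr_lge0 _ (bX_gt0 m)) scaled_shift addr_ge0.
rewrite -(ltr_pM2r (bX_gt0 m)) scaled_shift mul1r.
apply: (@lt_le_trans _ _ (numeral b (add_digits b x w) m).+1%:R).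
  by rewrite -nat1r ltrD2r.
by rewrite -natrX ler_nat numeral_bound.
Qed.

Lemma digit_shift k : (k < m)%N ->
  digit b (of_digits b (add_digits b x w) : R) k = add_digits b x w k.
Proof.
case/andP: of_digits_add_itv => y_ge0 _.
apply: digit_of_truncn => //; apply/eqP.
rewrite truncn_eq ?mulr_ge0 ?bX_ge0 // scaled_shift.
by case/andP: frac_itv => f_ge0 f_lt1; rewrite lerDr f_ge0 -nat1r ltrD2r.
Qed.

End Shift.

Lemma valuation_eq (v : nat -> nat) k :
  (forall j, (j < k)%N -> v j = 0%N) -> v k != 0%N ->
  valuation b v = b%:R ^- k.+1 :> R.
Proof.
move=> v0 vk; rewrite /valuation; case: pselect => [ex|[]]; last by exists k.
case: ex_minnP => j vj /(_ _ vk) jk.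
by case: (ltngtP j k) jk vj => // [jk|->//] _; rewrite v0.
Qed.

End RealDigits.

(** * Cutting an anchored box into a grid of boxes *)

Lemma indicator_telescope (R : realType) (g : nat -> R) (y : R) n :
  {homo g : k l / (k <= l)%N >-> k <= l} ->
  nat_of_bool (g 0%N <= y < g n) = (\sum_(k < n) (g k <= y < g k.+1)%R)%N.
Proof.
move=> g_homo; elim: n => [|n IHn].
  by rewrite big_ord0; case: leP => //= gy; rewrite ltNge gy.
rewrite big_ord_recr /= -IHn.
have g0n := g_homo 0%N n (leq0n n); have gn := g_homo n n.+1 (leqnSn n).
case: (leP (g 0%N) y) => [|yg0]; case: (ltP y (g n)) => [ygn|gny] //=.
- by rewrite (lt_le_trans ygn gn).
- by rewrite add0n; case: leP => //; have := le_trans g0n gny; rewrite leNgt yg0.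
Qed.

Section BoxPartition.
Context {R : realType} {s m N : nat}.
Variables (y : 'I_N -> 'rV[R]_s) (g : 'I_s -> nat -> R).
Hypothesis g_homo : forall i, {homo g i : k l / (k <= l)%N >-> k <= l}.

(** The indicator of a box is a product over coordinates. Writing each factor as a sum over
    consecutive intervals and distributing gives one box per choice function [f]. *)
Lemma count_box_split :
  count_box y (\row_i g i 0%N) (\row_i g i m) =
  (\sum_(f : {ffun 'I_s -> 'I_m})
     count_box y (\row_i g i (f i)) (\row_i g i (f i).+1))%N.
Proof.
have countE lo hi : count_box y lo hi =
    (\sum_n \prod_i (lo 0 i <= y n 0 i < hi 0 i)%R)%N.
  rewrite /count_box -sum1_card big_mkcond; apply: eq_bigr => n _ /=.
  rewrite inE /in_box; case: forallP => [yP|/forallP].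
    by rewrite big1 // => i _; rewrite yP.
  rewrite negb_forall => /existsP[i /negbTE yi].
  by rewrite (bigD1 i) //= yi mul0n.
rewrite countE; under eq_bigr => n _.
  under eq_bigr => i _ do rewrite !mxE indicator_telescope //.
  rewrite bigA_distr_bigA; over.
rewrite exchange_big; apply: eq_bigr => f _; rewrite countE.
by apply: eq_bigr => n _; apply: eq_bigr => i _; rewrite !mxE.
Qed.

Lemma Delta_split : (forall i, g i 0%N = 0) ->
  Delta y (\row_i g i m) =
  \sum_(f : {ffun 'I_s -> 'I_m})
    ((count_box y (\row_i g i (f i)) (\row_i g i (f i).+1))%:R -
     N%:R * vol (\row_i g i (f i)) (\row_i g i (f i).+1)).
Proof.
move=> g0; rewrite /Delta.
have -> : 0 = \row_i g i 0%N by apply/rowP => i; rewrite !mxE g0.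
rewrite count_box_split natr_sum sumrB -mulr_sumr; congr (_ - _ * _).
(* The volume is expanded in the same way, each side length being a telescoping sum. *)
under eq_bigr => i _.
  rewrite mxE -[g i m]subr0 -(g0 i) -(telescope_sumr _ (leq0n m)) big_mkord.
  over.
rewrite bigA_distr_bigA; apply: eq_bigr => f _.
by apply: eq_bigr => i _; rewrite !mxE.
Qed.

End BoxPartition.

(** Undoes a digitwise shift; [b - q] stands for [- q] modulo [b]. *)
Lemma addn_mod_eq b p q r : (p < b)%N -> (q < b)%N -> (r < b)%N ->
  ((p + q) %% b == r)%N = (p == (r + (b - q)) %% b)%N.
Proof.
have mod2 n : (n < b + b)%N -> (n %% b)%N = if (n < b)%N then n else (n - b)%N.
  move=> n2; case: ltnP => nb; first by rewrite modn_small.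
  by rewrite -{1}(subnK nb) modnDr modn_small // ltn_subLR.
move=> pb qb rb; rewrite !mod2; [|lia|lia].
by case: ltnP => h1; case: ltnP => h2; lia.
Qed.

Lemma eq_numeralP b (u v : nat -> nat) n :
  (forall k, (u k < b)%N) -> (forall k, (v k < b)%N) ->
  reflect (forall k, (k < n)%N -> u k = v k) (numeral b u n == numeral b v n).
Proof.
move=> ub vb; apply: (iffP eqP); first exact: numeral_inj.
exact: eq_numeral.
Qed.

Lemma Dstar_ge (R : realType) (s N : nat) (y : 'I_N -> 'rV[R]_s) (g : 'rV[R]_s) :
  (0 < N)%N -> (forall i, 0 < g 0 i <= 1) -> `|Delta y g| <= N%:R * Dstar y.
Proof.
move=> N_gt0 g01; have N0 : 0 < N%:R :> R by rewrite ltr0n.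
rewrite mulrC -ler_pdivrMr //; apply: ub_le_sup; last by exists g.
(* The supremum needs an upper bound: the count and [N] times the volume are each at most [N]. *)
exists 2 => _ [h h01 <-]; rewrite ler_pdivrMr // /Delta.
apply: le_trans (ler_normB _ _) _; rewrite mulrDl mul1r lerD //.
  by rewrite normr_nat ler_nat /count_box (leq_trans (max_card _)) // card_ord.
rewrite normrM normr_nat ler_piMr ?ler0n // ger0_norm.
  by apply: prodr_ile1 => i _; case/andP: (h01 i) => /ltW -> ->.
by apply: prodr_ge0 => i _; case/andP: (h01 i) => /ltW.
Qed.

(** * Local discrepancies of the shifted net *)

Section ShiftedNet.
Context {R : realType} {b s d t m : nat}.
Hypotheses (b_gt1 : (1 < b)%N) (s_gt0 : (0 < s)%N) (d_gt0 : (0 < d)%N).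
Variable x : 'I_(b ^ m) -> 'rV[R]_s.
Hypotheses (hadm : admissible d x) (hnet : is_net t x).
Variables (e : 'I_s -> nat -> bool) (n0 : 'I_(b ^ m)) (w : 'rV[R]_s).
Hypotheses (n0E : n0 = 0%N :> nat) (wE : forall i, E_ b m (w 0 i)).
Hypothesis shift_n0 : forall i k, (k < m)%N ->
  add_digits b (x n0 0 i) (w 0 i) k = e i k.

Let y n := oplus b (x n) w.

(** The cut points of coordinate [i]: they run from 0 at [k = 0] to [gamma_i] at [k = m], and move
    exactly at the digits 1. *)
Definition corner (i : 'I_s) (k : nat) : R :=
  \sum_(l < k) (e i l)%:R * b%:R ^- l.+1.

Let b_gt0 : (0 < b)%N. Proof. exact: ltnW. Qed.

Let bX_gt0 n : 0 < b%:R ^+ n :> R. Proof. by rewrite exprn_gt0 ?ltr0n. Qed.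

Lemma cornerS i k : corner i k.+1 = corner i k + (e i k)%:R * b%:R ^- k.+1.
Proof. by rewrite /corner big_ord_recr. Qed.

Lemma corner_homo i : {homo corner i : k l / (k <= l)%N >-> k <= l}.
Proof.
apply: homo_leq => [//|? ? ?|k]; first exact: le_trans.
by rewrite cornerS lerDl mulr_ge0 ?ler0n // invr_ge0 ltW.
Qed.

Let x01 n i : 0 <= x n 0 i < 1. Proof. by case: hnet. Qed.

(* The digits of the points in the [f]-th box: those of [corner] up to
   position [f i], where the digit 1 drops to 0. *)
Let boxdig (f : {ffun 'I_s -> 'I_m}) (i : 'I_s) (l : nat) : nat :=
  (l != f i :> nat) && e i l.

Let boxdig_lt f i l : (boxdig f i l < b)%N.
Proof. by apply: leq_ltn_trans b_gt1; apply: leq_b1. Qed.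

Let add_lt n (i : 'I_s) l : (add_digits b (x n 0 i)%R (w 0 i)%R l < b)%N.
Proof. by rewrite ltn_mod. Qed.

Notation lo f := (\row_i corner i (f i)).
Notation hi f := (\row_i corner i (f i).+1).

Section Box.
Variable f : {ffun 'I_s -> 'I_m}.
Hypothesis ef : forall i, e i (f i).

(** The digit 1 at [f i] adds one unit of its own place, so the two cut points bound an elementary
    interval of order [(f i).+1]. *)
Lemma corner_box i :
  corner i (f i) = (numeral b (boxdig f i) (f i).+1)%:R * b%:R ^- (f i).+1 /\
  corner i (f i).+1 =
    (numeral b (boxdig f i) (f i).+1).+1%:R * b%:R ^- (f i).+1.
Proof.
have E : corner i (f i) =
    (numeral b (boxdig f i) (f i).+1)%:R * b%:R ^- (f i).+1.
  rewrite -sum_digits_numeral // big_ord_recr /= /boxdig eqxx mul0r addr0.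
  by apply: eq_bigr => l _; rewrite neq_ltn ltn_ord.
by split; rewrite // cornerS E ef -mulrDl natr1.
Qed.

Lemma in_box_shift n :
  in_box (lo f) (hi f) (y n) =
  [forall i, numeral b (add_digits b (x n 0 i) (w 0 i)) (f i).+1
             == numeral b (boxdig f i) (f i).+1].
Proof.
apply: eq_forallb => i; rewrite !mxE; case: (corner_box i) => -> ->.
rewrite elem_interval_numeral ?(of_digits_add_itv _ _ (wE i)) //.
congr (_ == _); apply: eq_numeral => k kf.
by rewrite (digit_shift _ _ (wE i)) // (leq_trans kf).
Qed.

Lemma vol_box : vol (lo f) (hi f) = b%:R ^- (\sum_i (f i).+1).
Proof.
rewrite -exprVn -prodrXr; apply: eq_bigr => i _.
by rewrite !mxE cornerS ef mul1r addrC addKr exprVn.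
Qed.

Lemma count_box_net : (\sum_i (f i).+1 <= m - t)%N ->
  (count_box y (lo f) (hi f))%:R = b%:R ^+ m * vol (lo f) (hi f).
Proof.
move=> fmt; case: hnet => tm _ _ net.
(* [back] subtracts the digits of [w] from those of the box: a shifted point is in the box iff the
   original point is in the elementary box [a], which has the same volume. *)
pose back i l := ((boxdig f i l + (b - digit b (w 0 i)%R l)) %% b)%N.
have back_lt i l : (back i l < b)%N by rewrite ltn_mod.
pose a i := numeral b (back i) (f i).+1.
pose k i := (f i).+1 : nat.
have volE : vol (elem_lo b k a : 'rV[R]_s) (elem_hi b k a) =
    b%:R ^- (\sum_i (f i).+1).
  rewrite -exprVn -prodrXr; apply: eq_bigr => i _.
  by rewrite !mxE -mulrBl -natr1 addrC addKr mul1r exprVn.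
rewrite vol_box -volE -(net k a).
- congr (_%:R); apply: eq_card => n; rewrite !inE in_box_shift.
  apply: eq_forallb => i; rewrite !mxE elem_interval_numeral //.
  have dig_lt l : (digit b (x n 0 i)%R l < b)%N by apply: digit_lt.
  apply/eq_numeralP/eq_numeralP => // E l /E /eqP.
    by rewrite addn_mod_eq ?digit_lt // => /eqP.
  by rewrite -addn_mod_eq ?digit_lt // => /eqP.
- by move=> i; apply: numeral_bound.
- by move=> i; apply: dvd1n.
- rewrite /= volE lef_pV2 ?posrE // ler_eXn2l ?ltr1n //.
Qed.

(* A point of the box agrees with the shifted reference point exactly up to the
   digits [f i], so admissibility applied to the two points bounds the sum. *)
Lemma count_box_admissible : (m + d <= \sum_i (f i).+1)%N ->
  count_box y (lo f) (hi f) = 0%N.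
Proof.
move=> mdf; apply: eq_card0 => n; rewrite !inE in_box_shift.
apply/negP => /forallP ybox.
have yE i l : (l <= f i)%N -> add_digits b (x n 0 i) (w 0 i) l = boxdig f i l.
  by have /eq_numeralP := ybox i; apply.
pose i0 : 'I_s := Ordinal s_gt0.
have n_gt0 : (n0 < n)%N.
  (* The reference point is outside the box: its shifted digit at [f i0] is 1, where the box
     requires 0. *)
  rewrite n0E lt0n; apply/eqP => nE.
  have {nE} nE : n = n0 by apply: val_inj; rewrite /= n0E.
  by have := yE i0 _ (leqnn _); rewrite nE shift_n0 // /boxdig eqxx ef.
have := hadm n_gt0; rewrite /ominus_valuation.
rewrite (eq_bigr (fun i => b%:R ^- (f i).+1)); last first.
  move=> i _; apply: valuation_eq.
    move=> l lf; have := yE i l (ltnW lf); rewrite /boxdig (ltn_eqF lf) /=.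
    rewrite -shift_n0 ?(ltn_trans lf) // => /eqP; rewrite eqn_modDr => /eqP.
    rewrite !(modn_small (digit_lt _ _ _)) // /sub_digits => ->.
    by rewrite subnKC ?modnn // ltnW ?digit_lt.
  have := yE i _ (leqnn _); have := shift_n0 i (ltn_ord (f i)).
  rewrite /boxdig eqxx ef /= /add_digits /sub_digits => e1 e0.
  have xb : (digit b (x n 0 i)%R (f i) < b)%N by rewrite digit_lt.
  have x0b : (digit b (x n0 0 i)%R (f i) < b)%N by rewrite digit_lt.
  rewrite eq_sym -addn_mod_eq // add0n modn_small // eq_sym.
  by apply: contra_eq_neq e1 => <-; rewrite e0.
rewrite (eq_bigr (fun i => b%:R^-1 ^+ (f i).+1)) => [|i _]; last by rewrite exprVn.
rewrite prodrXr exprVn ltf_pV2 ?posrE // ltr_eXn2l ?ltr1n //.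
by rewrite ltnNge mdf.
Qed.

End Box.

(* A box with some [e i (f i) = 0] is empty of volume 0; of the others, large
   boxes are fair, and small ones are empty. *)
Lemma Delta_shift :
  (forall f : {ffun 'I_s -> 'I_m}, (forall i, e i (f i)) ->
     (\sum_i (f i).+1 <= m - t)%N \/ (m + d <= \sum_i (f i).+1)%N) ->
  Delta y (\row_i corner i m) <=
  - \sum_(f : {ffun 'I_s -> 'I_m}
          | [forall i, e i (f i)] && (\sum_i (f i).+1 == m + d)%N) b%:R ^- d.
Proof.
move=> gap; rewrite (Delta_split _ corner_homo); last first.
  by move=> i; rewrite /corner big_ord0.
rewrite -sumrN [leRHS]big_mkcond; apply: ler_sum => f _; rewrite natrX.
case: (boolP [forall i, e i (f i)]) => [/forallP ef|] /=.
  have [fmt|mdf] := gap f ef.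
    rewrite count_box_net // subrr; case: eqP => // fmd.
    by move: fmt; rewrite fmd; lia.
  rewrite count_box_admissible // sub0r vol_box //.
  case: eqP => [->|_].
    by rewrite exprD invfM mulrA divff ?mul1r // lt0r_neq0.
  by rewrite oppr_le0 mulr_ge0 ?invr_ge0 // ltW.
rewrite negb_forall => /existsP[i /negbTE eif].
have gS : corner i (f i).+1 = corner i (f i) by rewrite cornerS eif mul0r addr0.
rewrite /vol (bigD1 i) //= !mxE gS subrr mul0r mulr0 subr0.
rewrite [count_box _ _ _]eq_card0 // => n; rewrite !inE.
apply/negP => /forallP/(_ i); rewrite !mxE gS => /andP[lo_y].
by rewrite ltNge lo_y.
Qed.

End ShiftedNet.

(** Points of [E_ b m] have numerators below [b ^ m], so a maximiser is sought among finitely many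
    numerator vectors, filtered by membership; the zero vector is a candidate. *)
Lemma E_has_max (R : realType) (b s m : nat) (F : 'rV[R]_s -> R) : (1 < b)%N ->
  exists M, is_max [set F w | w in [set w : 'rV[R]_s | forall i, E_ b m (w 0 i)]] M.
Proof.
move=> b_gt1; have bm_gt0 : (0 < b ^ m)%N by rewrite expn_gt0 ltnW.
pose vec (a : {ffun 'I_s -> 'I_(b ^ m)}) : 'rV[R]_s := \row_i ((a i)%:R * b%:R ^- m).
pose P a := `[< forall i, E_ b m (vec a 0 i) >].
have P0 : P [ffun=> Ordinal bm_gt0].
  apply/asboolP => i; rewrite !mxE ffunE /= mul0r.
  have := @E_finite_sum R b b_gt1 (fun=> 0%N) m (fun=> ltnW b_gt1).
  by rewrite big1 // => k _; rewrite mul0r.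
case: (arg_maxP (F \o vec) P0) => a /asboolP Pa a_max.
exists (F (vec a)); split; first by exists (vec a).
move=> _ [w wE <-].
have wa i : exists c : 'I_(b ^ m), w 0 i = c%:R * b%:R ^- m.
  by have [c c_lt ->] := E_numeral b_gt1 (wE i); exists (Ordinal c_lt).
have [c cE] := choice wa.
have -> : w = vec (finfun c) by apply/rowP => i; rewrite mxE ffunE cE.
by apply: a_max; apply/asboolP => i; rewrite mxE ffunE -cE.
Qed.

(** * Digit positions in arithmetic progressions *)

Section Progressions.
Variables (A c s m : nat).

(** Coordinate 0 carries the whole residue [c] and the others are multiples of [A], which fixes the
    sum modulo [A]. Positions count from 1, hence [k.+1]. *)
Definition progression (i : 'I_s.+1) (k : nat) : bool :=
  if i == ord0 then (k.+1 == c %[mod A])%N else (A %| k.+1)%N.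

Lemma sum_progression (f : 'I_s.+1 -> nat) :
  (forall i, progression i (f i)) -> (\sum_i (f i).+1 = c %[mod A])%N.
Proof.
move=> fP; rewrite big_ord_recl -modnDmr.
have /eqP -> : (A %| \sum_(i < s) (f (lift ord0 i)).+1)%N.
  by apply: dvdn_sum => i _; have := fP (lift ord0 i).
by rewrite addn0; apply/eqP; apply: (fP ord0).
Qed.

(** The [s] coordinates other than 0 range freely over [A, 2A, ..., LA], with sum [T]; coordinate 0
    takes [c - T]. This is at least 1 as [T <= A s L < m <= c], and at most [m] as
    [T >= A >= c - m]. *)
Lemma card_progression L : (0 < A)%N -> (0 < s)%N -> (0 < L)%N ->
  (A * s * L < m)%N -> (m <= c)%N -> (c <= m + A)%N ->
  (L ^ s <= #|[pred f : {ffun 'I_s.+1 -> 'I_m} |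
     [forall i, progression i (f i)] && (\sum_i (f i).+1 == c)%N]|)%N.
Proof.
move=> A_gt0 s_gt0 L_gt0 ALm mc cmA.
have m_gt0 : (0 < m)%N by apply: leq_ltn_trans ALm.
pose T (h : {ffun 'I_s -> 'I_L}) := (\sum_j A * (h j).+1)%N.
(* [.-1] returns to positions counted from 0; [F0] and [FS] check that the default of [insubd] is
   never taken. *)
pose F (h : {ffun 'I_s -> 'I_L}) : {ffun 'I_s.+1 -> 'I_m} :=
  [ffun i => insubd (Ordinal m_gt0)
     (if unlift ord0 i is Some j then (A * (h j).+1).-1 else (c - T h).-1)%N].
have T_le h : (T h <= A * s * L)%N.
  rewrite -mulnA [(s * L)%N]mulnC mulnA -[X in (_ <= _ * X)%N](card_ord s).
  rewrite mulnC -sum_nat_const; apply: leq_sum => j _.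
  by rewrite leq_mul2l ltn_ord orbT.
have T_ge h : (A <= T h)%N.
  rewrite /T (bigD1 (Ordinal s_gt0)) //=; apply: leq_trans (leq_addr _ _).
  by rewrite mulnS leq_addr.
have F0 h : (F h ord0).+1 = (c - T h)%N.
  rewrite ffunE unlift_none val_insubd.
  have := T_le h; have := T_ge h => ? ?.
  by rewrite ifT ?prednK //; lia.
have FS h j : (F h (lift ord0 j)).+1 = (A * (h j).+1)%N.
  rewrite ffunE liftK val_insubd.
  have hm : (A * (h j).+1 < m)%N.
    apply: leq_ltn_trans ALm; rewrite -mulnA leq_mul2l.
    by rewrite (leq_trans (ltn_ord (h j))) ?orbT // leq_pmull.
  by rewrite ifT ?prednK ?muln_gt0 ?A_gt0 // ltnW.
have F_inj : injective F.
  move=> h h' hh; apply/ffunP => j; apply: val_inj => /=.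
  have := FS h j; rewrite hh FS => /eqP.
  by rewrite eqn_pmul2l // eqSS => /eqP.
have F_sum h : (\sum_i (F h i).+1 = c)%N.
  rewrite big_ord_recl F0 (eq_bigr _ (fun j _ => FS h j)) subnK //.
  by rewrite (leq_trans (T_le h)) // (leq_trans (ltnW ALm)).
rewrite -{1}(card_ord L) -{1}(card_ord s) -card_ffun -(card_imset _ F_inj).
apply: subset_leq_card; apply/fintype.subsetP => _ /imsetP[h _ ->].
rewrite !inE F_sum eqxx andbT; apply/forallP => i; rewrite /progression.
case: (unliftP ord0 i) => [j ->|->].
  by rewrite eq_sym (negbTE (neq_lift _ _)) FS dvdn_mulr.
rewrite eqxx F0 eq_sym.
have A_T : (A %| T h)%N by apply: dvdn_sum => j _; rewrite dvdn_mulr.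
have Tc : (T h <= c)%N by rewrite (leq_trans (T_le h)) // (leq_trans (ltnW ALm)).
by rewrite eqn_mod_dvd ?leq_subr // subKn.
Qed.

End Progressions.

(** * Choice of the parameters and conclusion *)

Theorem theorem1 (R : realType) (b s d t m : nat)
    (hb : (2 <= b)%N) (hs : (2 <= s)%N) (hd : (1 <= d)%N) (ht : (t <= m)%N)
    (hm : (9 * (d + t) * (s - 1) ^ 2 <= m)%N)
    (x : 'I_(b ^ m) -> 'rV[R]_s)
    (hadm : admissible d x) (hnet : is_net t x) :
  exists M : R,
    is_max [set b%:R ^+ m * Dstar (fun n => oplus b (x n) w)
           | w in [set w : 'rV[R]_s | forall i, E_ b m (w 0 i)]] M /\
    b%:R ^- d * (K_ d t s)%:R ^- (s - 1) * m%:R ^+ (s - 1) <= M.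
Proof.
case: s hs hm x hadm hnet => [//|s].
(* From here on [s] is the dimension minus one. *)
rewrite ltnS subn1 succnK => s_gt0 hm x hadm hnet.
have [M [M_in M_ub]] := E_has_max m
  (fun w => b%:R ^+ m * Dstar (fun n => oplus b (x n) w)) hb.
exists M; split=> //.
have bm_gt0 : (0 < b ^ m)%N by rewrite expn_gt0 ltnW.
pose n0 := Ordinal bm_gt0.
pose e := @progression (d + t) (m + d) s.
have e_lt i k : (e i k < b)%N by apply: leq_ltn_trans hb; apply: leq_b1.
pose v i k := ((e i k + (b - digit b (x n0 0 i)%R k)) %% b)%N.
have v_lt i k : (v i k < b)%N by rewrite ltn_mod ltnW.
pose w : 'rV[R]_s.+1 := \row_i \sum_(k < m) (v i k)%:R * b%:R ^- k.+1.
have wE i : E_ b m (w 0 i) by rewrite mxE; apply: E_finite_sum.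
have shift_n0 i k : (k < m)%N -> add_digits b (x n0 0 i) (w 0 i) k = e i k.
  move=> km; rewrite /add_digits mxE digit_finite_sum // km addnC.
  by apply/eqP; rewrite addn_mod_eq ?digit_lt.
pose gam : 'rV[R]_s.+1 := \row_i corner (b := b) e i m.
(* Rounding up past [m / K] ensures [m <= L * K], which yields the final bound. *)
pose L := (m %/ K_ d t s.+1).+1.
have KE : K_ d t s.+1 = (4 * (d + t) * s ^ 2)%N by rewrite /K_ subn1.
have K_gt0 : (0 < K_ d t s.+1)%N.
  by rewrite KE !muln_gt0 addn_gt0 hd s_gt0.
have ALm : ((d + t) * s * L < m)%N.
  (* The left side is at most [m / (4 s) + (d + t) s], hence at most [m / 4 + m / 9]. *)
  have := leq_trunc_div m (K_ d t s.+1); rewrite KE /L; nia.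
have cardL : (L ^ s <= #|[pred f : {ffun 'I_s.+1 -> 'I_m} |
    [forall i, e i (f i)] && (\sum_i (f i).+1 == m + d)%N]|)%N.
  apply: card_progression ALm _ _; rewrite ?addn_gt0 ?hd ?leq_addr //.
  by rewrite leq_add2l leq_addr.
have gam01 i : 0 < gam 0 i <= 1.
  (* The count just obtained is positive, so every coordinate of [gam] has a digit 1 and is
     nonzero. *)
  have [f /andP[/forallP ef _]] : exists f : {ffun 'I_s.+1 -> 'I_m},
      [forall i, e i (f i)] && (\sum_i (f i).+1 == m + d)%N.
    by apply/card_gt0P; apply: leq_trans cardL; rewrite expn_gt0.
  have /andP[_ /ltW gam_le1] := @finite_sum_itv R b hb _ m (e_lt i).
  rewrite mxE /corner gam_le1 andbT (bigD1 (f i)) //= ef mul1r.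
  rewrite ltr_wpDr ?invr_gt0 ?exprn_gt0 ?ltr0n ?(ltnW hb) //.
  by apply: sumr_ge0 => k _; rewrite divr_ge0 ?exprn_ge0.
have gap (f : {ffun 'I_s.+1 -> 'I_m}) : (forall i, e i (f i)) ->
    (\sum_i (f i).+1 <= m - t)%N \/ (m + d <= \sum_i (f i).+1)%N.
  move=> /(@sum_progression (d + t) (m + d) s (fun i => f i)) /eqP.
  set S := (\sum_i _)%N; case: (leqP (m + d) S) => [|S_lt]; first by right.
  (* A sum below [m + d] falls short of it by a positive multiple of [d + t], so it is at most
     [m - t]. *)
  rewrite eq_sym eqn_mod_dvd ?(ltnW S_lt) // => /dvdn_leq.
  rewrite subn_gt0 => /(_ S_lt).
  by left; lia.
have n0E : n0 = 0%N :> nat by [].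
have /= := Delta_shift hb (ltn0Sn s) hd hadm hnet n0E wE shift_n0 gap.
rewrite sumr_const; set Dlt := Delta _ _ => Dlt_le.
have Dlt_ge : b%:R ^- d * (L ^ s)%:R <= `|Dlt|.
  rewrite -normrN; apply: le_trans (ler_norm _); rewrite lerNr.
  apply: le_trans Dlt_le _; rewrite lerN2 -[leRHS]mulr_natr.
  by rewrite ler_wpM2l ?invr_ge0 ?exprn_ge0 // ler_nat.
have DM : b%:R ^+ m * Dstar (fun n => oplus b (x n) w) <= M.
  by apply: M_ub; exists w.
apply: le_trans DM.
have := Dstar_ge (fun n => oplus b (x n) w) bm_gt0 gam01; rewrite natrX.
apply: le_trans; apply: le_trans Dlt_ge.
rewrite -mulrA ler_wpM2l ?invr_ge0 ?exprn_ge0 //.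
rewrite mulrC ler_pdivrMr ?exprn_gt0 ?ltr0n // natrX -exprMn.
rewrite lerXn2r ?nnegrE ?mulr_ge0 //.
by rewrite -natrM ler_nat ltnW // ltn_ceil.
Qed.
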